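(* Let $0\le l<n$. The number of elements of rank $r$ of $P_{n,l}$ is $$W_r=\binom{n}{r}\sum_{i=0}^l\binom{r-1}{i}\quad\text{for }1\le r\le n,$$ and the sequence $(W_1,\dots,W_n)$ is log-concave, i.e. $W_{i-1}W_{i+1}\le W_i^2$ for $2\le i\le n-1$; that is, $P_{n,l}$ is rank-log-concave.
   Context: A projective sign vector of length $n$ is an element of $\{0,+,-\}^n\setminus\{(0,\dots,0)\}$ modulo the identification $(v_1,\dots,v_n)\sim(-v_1,\dots,-v_n)$. Its number of sign changes is the number of sign changes in the sequence of its nonzero entries (read left to right). For $0\le l<n$, $P_{n,l}$ is the poset of projective sign vectors of length $n$ with at most $l$ sign changes, where $v\le w$ iff for suitable representatives $v_i\in\{0,w_i\}$ for all $1\le i\le n$. It is graded with ranks labeled $1$ to $n$, the rank of $v$ being its number of nonzero entries. *)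

(* Defs.v *)
From HB Require Import structures.
From mathcomp Require Export all_boot all_order.
From mathcomp Require Import generic_quotient.

Set Implicit Arguments.
Unset Strict Implicit.
Unset Printing Implicit Defensive.

Import Order.Theory.
Local Open Scope quotient_scope.

Inductive sign := Zero | Plus | Minus.

Definition sign_code (x : sign) : option bool :=
  match x with Zero => None | Plus => Some true | Minus => Some false end.
Definition sign_decode (b : option bool) : sign :=
  match b with None => Zero | Some true => Plus | Some false => Minus end.
Lemma sign_codeK : cancel sign_code sign_decode. Proof. by case. Qed.
HB.instance Definition _ := Finite.copy sign (can_type sign_codeK).

Definition sopp (x : sign) : sign :=
  match x with Zero => Zero | Plus => Minus | Minus => Plus end.

Definition support_seq (s : seq sign) : seq sign := [seq x <- s | x != Zero].

(* Number of pairs of consecutive entries that differ. *)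
Definition jumps (s : seq sign) : nat :=
  count (fun p => p.1 != p.2) (zip s (behead s)).

Definition sign_changes (s : seq sign) : nat := jumps (support_seq s).

Definition nb_nonzero (s : seq sign) : nat := count (fun x => x != Zero) s.

Definition nzvec (n : nat) := {v : n.-tuple sign | v != [tuple Zero | _ < n]}.
HB.instance Definition _ n := Finite.on (nzvec n).

(* Equality up to a global sign. *)
Definition nzvec_rel {n} (v w : nzvec n) : bool :=
  (val v == val w) || (val v == [tuple of map sopp (val w)]).

Lemma soppK : involutive sopp. Proof. by case. Qed.

Lemma map_soppK n (v : n.-tuple sign) :
  [tuple of map sopp [tuple of map sopp v]] = v.
Proof. by apply: val_inj => /=; rewrite mapK //; exact: soppK. Qed.

Lemma nzvec_relP n : equiv_class_of (@nzvec_rel n).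
Proof.
split=> [v | v w | w v u]; rewrite /nzvec_rel ?eqxx //.
  rewrite eq_sym; congr (_ || _).
  by apply/eqP/eqP => ->; rewrite map_soppK.
case/orP=> /eqP-> // /orP[] /eqP->; first by rewrite eqxx orbT.
by rewrite map_soppK eqxx.
Qed.

Canonical nzvec_equiv n := EquivRelPack (@nzvec_relP n).

Definition psv (n : nat) := {eq_quot @nzvec_equiv n}.
HB.instance Definition _ n := Choice.on (psv n).
HB.instance Definition _ n := EqQuotient.on (psv n).
HB.instance Definition _ n : isCountable (psv n) :=
  CanIsCountable (@reprK _ (psv n)).
HB.instance Definition _ n : isFinite (psv n) := CanIsFinite (@reprK _ (psv n)).

(* Both are independent of the representative: see [psv_changes_pi] and
   [psv_rank_pi]. *)
Definition psv_changes {n} (C : psv n) : nat := sign_changes (val (repr C)).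
Definition psv_rank {n} (C : psv n) : nat := nb_nonzero (val (repr C)).

Definition vec_le {n} (v w : n.-tuple sign) : bool :=
  [forall i, (tnth v i == Zero) || (tnth v i == tnth w i)].

Definition psv_le {n} (C D : psv n) : bool :=
  [exists v : nzvec n, exists w : nzvec n,
    [&& \pi_(psv n) v == C, \pi_(psv n) w == D & vec_le (val v) (val w)]].

Lemma psv_eqE n (v w : nzvec n) : (\pi_(psv n) v == \pi w) = nzvec_rel v w.
Proof. by rewrite eqmodE. Qed.

Lemma nzvec_rel_repr n (v : nzvec n) : nzvec_rel (repr (\pi_(psv n) v)) v.
Proof. by rewrite -psv_eqE reprK. Qed.

Lemma nb_nonzero_opp s : nb_nonzero (map sopp s) = nb_nonzero s.
Proof. by rewrite /nb_nonzero count_map; apply: eq_count => -[]. Qed.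

Lemma sign_changes_opp s : sign_changes (map sopp s) = sign_changes s.
Proof.
rewrite /sign_changes.
have -> : support_seq (map sopp s) = map sopp (support_seq s).
  by rewrite /support_seq filter_map; congr map; apply: eq_filter => -[].
elim: (support_seq s) => [|x [|y t] IH] //=; move: IH.
by rewrite /jumps /= => ->; rewrite (inj_eq (inv_inj soppK)).
Qed.

Lemma psv_changes_pi n (v : nzvec n) :
  psv_changes (\pi_(psv n) v) = sign_changes (val v).
Proof.
by rewrite /psv_changes; case/orP: (nzvec_rel_repr v) => /eqP-> //;
  exact: sign_changes_opp.
Qed.

Lemma psv_rank_pi n (v : nzvec n) :
  psv_rank (\pi_(psv n) v) = nb_nonzero (val v).
Proof.
by rewrite /psv_rank; case/orP: (nzvec_rel_repr v) => /eqP-> //;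
  exact: nb_nonzero_opp.
Qed.

Lemma vec_leP n (v w : n.-tuple sign) :
  reflect (forall i, tnth v i = Zero \/ tnth v i = tnth w i) (vec_le v w).
Proof.
apply: (iffP forallP) => H i; first by case/orP: (H i) => /eqP; tauto.
by apply/orP; case: (H i) => ->; [left | right].
Qed.

Lemma nb_nonzeroE n (v : n.-tuple sign) :
  nb_nonzero v = #|[set i | tnth v i != Zero]|.
Proof.
by rewrite /nb_nonzero -sum1_count big_tuple sum1dep_card.
Qed.

Lemma vec_le_rank n (v w : n.-tuple sign) :
  vec_le v w -> nb_nonzero v <= nb_nonzero w ?= iff (v == w).
Proof.
move/vec_leP=> H; rewrite !nb_nonzeroE.
have sub : [set i | tnth v i != Zero] \subset [set i | tnth w i != Zero].
  apply/subsetP=> i; rewrite !inE.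
  by case: (H i) => ->; rewrite ?eqxx.
split; first exact: subset_leq_card.
rewrite (subset_leqif_cards sub); apply/eqP/eqP => [E | -> //].
apply: eq_from_tnth => i; case: (H i) => // vi0.
move/setP/(_ i): E; rewrite !inE vi0 eqxx /= => /esym/negbFE/eqP ->.
by [].
Qed.

Lemma psv_leE n (C : psv n) (w : nzvec n) :
  psv_le C (\pi w) -> exists2 v : nzvec n, C = \pi v & vec_le (val v) (val w).
Proof.
case/existsP=> v /existsP[w'] /and3P[/eqP <-]; rewrite psv_eqE.
case/orP=> /eqP Ew le_vw'; first by exists v => //; rewrite -Ew.
have nz : [tuple of map sopp (val v)] != [tuple Zero | _ < n].
  apply: contraNN (valP v) => /eqP E; rewrite -[val v]map_soppK E.
  by apply/eqP/eq_from_tnth => i; rewrite tnth_map !tnth_mktuple.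
pose u : nzvec n := exist (fun v : n.-tuple sign => v != _) _ nz.
exists u; first by apply/eqP; rewrite psv_eqE /nzvec_rel /= map_soppK eqxx orbT.
rewrite /=; apply/vec_leP=> i; rewrite tnth_map.
case: (vec_leP _ _ le_vw' i) => ->; first by left.
by right; rewrite Ew tnth_map soppK.
Qed.

Lemma psv_le_pi n (v w : nzvec n) :
  vec_le (val v) (val w) -> psv_le (\pi_(psv n) v) (\pi w).
Proof.
by move=> H; apply/existsP; exists v; apply/existsP; exists w; rewrite !eqxx.
Qed.

Lemma psv_le_refl n : reflexive (@psv_le n).
Proof.
by move=> C; rewrite -[C]reprK; apply: psv_le_pi; apply/vec_leP; right.
Qed.

Lemma psv_le_rank n (C D : psv n) :
  psv_le C D -> psv_rank C <= psv_rank D ?= iff (C == D).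
Proof.
rewrite -[D]reprK => /psv_leE[v -> /vec_le_rank[le_vw eq_vw]].
rewrite !psv_rank_pi; split=> //; apply/idP/idP.
  by rewrite eq_vw => /eqP E; rewrite psv_eqE /nzvec_rel E eqxx.
by move/eqP=> E; rewrite -!psv_rank_pi E.
Qed.

Lemma psv_le_anti n : antisymmetric (@psv_le n).
Proof.
move=> C D /andP[/psv_le_rank[leCD eqCD] /psv_le_rank[leDC _]].
by apply/eqP; rewrite -eqCD eqn_leq leCD.
Qed.

Lemma psv_le_trans n : transitive (@psv_le n).
Proof.
move=> D C E leCD; rewrite -[E]reprK => /psv_leE[w ED le_wu].
move: leCD; rewrite {}ED => /psv_leE[v -> le_vw]; apply: psv_le_pi.
apply/vec_leP=> i; case: (vec_leP _ _ le_vw i) => ->; first by left.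
exact: (vec_leP _ _ le_wu i).
Qed.

Fact psv_display : Order.disp_t. Proof. exact: Order.Disp tt tt. Qed.

HB.instance Definition _ n := @Order.Le_isPOrder.Build psv_display (psv n)
  (@psv_le n) (@psv_le_refl n) (@psv_le_anti n) (@psv_le_trans n).

Definition Pnl (n l : nat) := {C : psv n | psv_changes C <= l}.
(* Ordered as an induced subposet of [psv n]. *)
HB.instance Definition _ n l := [isSub of Pnl n l for @proj1_sig _ _].
HB.instance Definition _ n l := [Finite of Pnl n l by <:].
HB.instance Definition _ n l :=
  [SubChoice_isSubPOrder of Pnl n l by <: with psv_display].

Definition Pnl_rank {n l} (C : Pnl n l) : nat := psv_rank (val C).

(* Ranks are labeled from 1 to [N], rather than from 0. *)
Definition graded {d} {T : finPOrderType d} (rk : T -> nat) (N : nat) : Prop :=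
  [/\ forall x : T, (forall y, ~~ (y < x)%O) -> rk x = 1,
      forall x : T, (forall y, ~~ (x < y)%O) -> rk x = N &
      forall x y : T, (x < y)%O -> (forall z, ~~ (x < z < y)%O) ->
        rk y = (rk x).+1].

Definition whitney {T : finType} (rk : T -> nat) (r : nat) : nat :=
  #|[set x | rk x == r]|.

Definition log_concave (a : nat -> nat) (N : nat) : Prop :=
  forall i, 2 <= i <= N - 1 -> a i.-1 * a i.+1 <= a i ^ 2.

Definition rank_log_concave {T : finType} (rk : T -> nat) (N : nat) : Prop :=
  log_concave (whitney rk) N.

Lemma jumps_cons2 x y s : jumps (x :: y :: s) = (x != y) + jumps (y :: s).
Proof. by []. Qed.

Lemma jumps_cons x s : jumps s <= jumps (x :: s).
Proof. by case: s => //= y s; rewrite jumps_cons2 leq_addl. Qed.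

Lemma jumps_subseq_cons s t x :
  subseq s t -> jumps (x :: s) <= jumps (x :: t).
Proof.
elim: t s x => [|y t IH] [|z s] x //= H.
case: eqP H => [-> H | _ H]; first by rewrite !jumps_cons2 leq_add2l IH.
apply: leq_trans (IH _ x H) _; rewrite jumps_cons2.
case: (t) => // u t'; rewrite !jumps_cons2 addnA leq_add2r.
by case: x y u {IH H t' t} => -[] [].
Qed.

Lemma jumps_subseq s t : subseq s t -> jumps s <= jumps t.
Proof.
elim: t s => [|y t IH] [|x s] //= H.
case: eqP H => [-> H | _ H]; first exact: jumps_subseq_cons.
exact: leq_trans (IH _ H) (jumps_cons _ _).
Qed.

Lemma vec_le_changes n (v w : n.-tuple sign) :
  vec_le v w -> sign_changes v <= sign_changes w.
Proof.
move/vec_leP=> H; apply: jumps_subseq.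
have E (u : n.-tuple sign) : support_seq u =
    [seq tnth u i | i <- [seq i <- enum 'I_n | tnth u i != Zero]].
  by rewrite /support_seq -{1}(map_tnth_enum u) filter_map.
rewrite !E.
have -> : [seq tnth v i | i <- [seq i <- enum 'I_n | tnth v i != Zero]] =
    [seq tnth w i | i <- [seq i <- enum 'I_n | tnth v i != Zero]].
  apply/eq_in_map => i; rewrite mem_filter => /andP[vi _].
  by case: (H i) => // vi0; rewrite vi0 eqxx in vi.
apply: map_subseq.
have -> : [seq i <- enum 'I_n | tnth v i != Zero] =
    [seq i <- [seq i <- enum 'I_n | tnth w i != Zero] | tnth v i != Zero].
  rewrite -filter_predI; apply: eq_filter => i /=.
  by case: (H i) => ->; rewrite ?eqxx ?andbb.
exact: filter_subseq.
Qed.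

Definition zero_at {n} (i : 'I_n) (w : n.-tuple sign) : n.-tuple sign :=
  [tuple if j == i then Zero else tnth w j | j < n].

Lemma zero_at_le n (i : 'I_n) w : vec_le (zero_at i w) w.
Proof. by apply/vec_leP=> j; rewrite tnth_mktuple; case: eqP; [left|right]. Qed.

Lemma zero_at_rank n (i : 'I_n) w :
  tnth w i != Zero -> nb_nonzero w = (nb_nonzero (zero_at i w)).+1.
Proof.
move=> wi; rewrite !nb_nonzeroE (cardsD1 i) inE wi add1n; congr _.+1.
apply: eq_card => j; rewrite !inE tnth_mktuple.
by case: (j == i) => //=; rewrite eqxx.
Qed.

Lemma nb_nonzero_gt0 n (v : n.-tuple sign) :
  (0 < nb_nonzero v) = (v != [tuple Zero | _ < n]).
Proof.
rewrite nb_nonzeroE card_gt0; congr negb; apply/eqP/eqP => [E | ->].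
  apply: eq_from_tnth => i; rewrite tnth_mktuple.
  by move/setP/(_ i): E; rewrite !inE => /negbFE/eqP.
by apply/setP=> i; rewrite !inE tnth_mktuple.
Qed.

Fixpoint fill (a : sign) (s : seq sign) : seq sign :=
  if s is x :: s' then
    let y := if x == Zero then a else x in y :: fill y s'
  else [::].

Lemma size_fill a s : size (fill a s) = size s.
Proof. by elim: s a => //= x s IH a; rewrite IH. Qed.

Lemma fill_nz a s : a != Zero -> nb_nonzero (fill a s) = size s.
Proof.
elim: s a => //= x s IH a a0.
have y0 : (if x == Zero then a else x) != Zero by case: ifPn.
by rewrite /nb_nonzero /= y0 add1n -[in RHS](IH _ y0).
Qed.

Lemma support_fill a s : a != Zero -> support_seq (fill a s) = fill a s.
Proof.
move=> a0; apply/all_filterP; rewrite all_count -/(nb_nonzero _).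
by rewrite fill_nz // size_fill.
Qed.

Lemma fill_le a s i : nth Zero s i = Zero \/ nth Zero s i = nth Zero (fill a s) i.
Proof.
elim: s a i => [|x s IH] a [|i] /=; [by left | by left | | exact: IH].
by case: eqP; [left | right].
Qed.

Lemma jumps_fill a s :
  a != Zero -> jumps (a :: fill a s) = jumps (a :: support_seq s).
Proof.
elim: s a => //= x s IH a a0; case: (eqVneq x Zero) => x0 /=.
  by rewrite jumps_cons2 eqxx IH.
by rewrite !jumps_cons2 IH.
Qed.

Lemma Pnl_graded n l : 0 < n -> @graded _ (Pnl n l) Pnl_rank n.
Proof.
move=> n_gt0.
have mk (v : n.-tuple sign) : 0 < nb_nonzero v -> sign_changes v <= l ->
    exists2 z : Pnl n l, Pnl_rank z = nb_nonzero v &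
      exists2 u : nzvec n, val z = \pi u & val u = v.
  rewrite nb_nonzero_gt0 => v0 vl.
  pose u : nzvec n := exist (fun v : n.-tuple sign => v != _) _ v0.
  have ul : psv_changes (\pi_(psv n) u) <= l by rewrite psv_changes_pi.
  exists (exist (fun C : psv n => psv_changes C <= l) _ ul).
    by rewrite /Pnl_rank psv_rank_pi.
  by exists u.
have rep (x : Pnl n l) : exists2 u : nzvec n, val x = \pi u &
    [/\ Pnl_rank x = nb_nonzero (val u), 0 < nb_nonzero (val u)
      & sign_changes (val u) <= l].
  exists (repr (val x)); first by rewrite reprK.
  split=> //; first by rewrite nb_nonzero_gt0; exact: (valP (repr (val x))).
  exact: (valP x).
have ltE (x y : Pnl n l) : (x <= y)%O -> Pnl_rank x < Pnl_rank y -> (x < y)%O.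
  by rewrite lt_neqAle => -> lt_rk; rewrite andbT; apply: contraTneq lt_rk => ->;
    rewrite ltnn.
have rk_lt (x y : Pnl n l) : (x < y)%O -> Pnl_rank x < Pnl_rank y.
  rewrite lt_neqAle leEsub => /andP[xy /psv_le_rank[le_rk eq_rk]].
  by rewrite /Pnl_rank ltn_neqAle le_rk eq_rk andbT.
have down (u : nzvec n) (y : Pnl n l) (i : 'I_n) : val y = \pi u ->
    tnth (val u) i != Zero -> 1 < Pnl_rank y ->
    exists2 z : Pnl n l, [/\ (z < y)%O & (Pnl_rank z).+1 = Pnl_rank y] &
      exists2 t : nzvec n, val z = \pi t & val t = zero_at i (val u).
  move=> yE ui; have yr : Pnl_rank y = nb_nonzero (val u).
    by rewrite /Pnl_rank yE psv_rank_pi.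
  rewrite yr (zero_at_rank ui) ltnS => pos.
  have ch : sign_changes (zero_at i (val u)) <= l.
    apply: leq_trans (vec_le_changes (zero_at_le i _)) _.
    by rewrite -psv_changes_pi -yE; exact: (valP y).
  have [z zr [t zE tE]] := mk _ pos ch; exists z; last by exists t.
  split; last by rewrite zr.
  apply: ltE; last by rewrite yr (zero_at_rank ui) zr.
  by rewrite leEsub zE yE; apply: psv_le_pi; rewrite tE zero_at_le.
split=> [x minx | x maxx | x y lt_xy cov].
- have [u xE [xr pos _]] := rep x.
  apply/eqP; rewrite eqn_leq [in 1 <= _]xr pos andbT leqNgt.
  apply/negP=> rk2; have [i ui] : exists i, tnth (val u) i != Zero.
    move: pos; rewrite nb_nonzeroE card_gt0 => /set0Pn[i].
    by rewrite inE; exists i.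
  by have [z [zx _] _] := down u x i xE ui rk2; have:= minx z; rewrite zx.
- have [u xE [xr pos ch]] := rep x.
  have [a0 | nz] := boolP (support_seq (val u) == [::]).
    by move: pos; rewrite /nb_nonzero -size_filter -/(support_seq _) (eqP a0).
  pose a := head Zero (support_seq (val u)).
  have aS : a :: behead (support_seq (val u)) = support_seq (val u).
    by rewrite /a; case: (support_seq _) nz.
  have a0 : a != Zero.
    have : a \in support_seq (val u) by rewrite -aS mem_head.
    by rewrite mem_filter => /andP[].
  have szf : size (fill a (val u)) == n by rewrite size_fill size_tuple.
  have fr : nb_nonzero (Tuple szf) = n by rewrite /= fill_nz // size_tuple.
  have fch : sign_changes (Tuple szf) <= l.
    rewrite /sign_changes /= support_fill //; apply: leq_trans (jumps_cons a _) _.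
    by rewrite jumps_fill // -aS jumps_cons2 eqxx aS.
  have fpos : 0 < nb_nonzero (Tuple szf) by rewrite fr.
  have [z zr [t zE tE]] := mk _ fpos fch.
  have le_xz : (x <= z)%O.
    rewrite leEsub xE zE; apply: psv_le_pi; rewrite tE; apply/vec_leP=> i.
    by rewrite !(tnth_nth Zero) /=; exact: fill_le.
  have := maxx z; rewrite lt_neqAle le_xz andbT negbK => /eqP ->.
  by rewrite zr fr.
- apply/eqP; rewrite eqn_leq (rk_lt _ _ lt_xy) andbT leqNgt.
  apply/negP=> gap; have [u yE _] := rep y.
  have: (val x <= val y)%O by rewrite -leEsub ltW.
  rewrite yE => /psv_leE[v xE le_vu].
  have [i vi ui] : exists2 i, tnth (val v) i = Zero & tnth (val u) i != Zero.
    have [/existsP[i /andP[/eqP]] | ] :=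
      boolP [exists i, (tnth (val v) i == Zero) && (tnth (val u) i != Zero)].
      by exists i.
    rewrite negb_exists => /forallP H; exfalso.
    have E : val v = val u.
      apply: eq_from_tnth => i; have := H i; rewrite negb_and negbK.
      by case: (vec_leP _ _ le_vu i) => [vi | //]; rewrite vi eqxx => /eqP.
    by move: lt_xy; rewrite ltEsub xE yE (val_inj E) ltxx.
  have rk2 : 1 < Pnl_rank y by apply: leq_trans gap; rewrite !ltnS.
  have [z [zy zr] [t zE tE]] := down u y i yE ui rk2.
  have xz : (x < z)%O.
    apply: ltE; last by rewrite -ltnS zr.
    rewrite leEsub xE zE; apply: psv_le_pi; rewrite tE; apply/vec_leP=> j.
    rewrite tnth_mktuple; case: eqP => [-> | _]; first by left.
    exact: (vec_leP _ _ le_vu j).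
  by have := cov z; rewrite xz zy.
Qed.

(* Main.v *)
(** Each class has a unique representative whose first nonzero entry is [Plus],
    so [W_r] counts the vectors with that property.  Reading a vector from left to
    right and remembering the last nonzero entry turns Pascal's rule into the
    recursion for this count.

    [W_r] is a product of two log-concave sequences.  For
    [S m = \sum_(i <= l) 'C(m, i)] one has [S m.+1 = 2 * S m - 'C(m, l)], so
    log-concavity says that [S m / 'C(m, l)] is non-increasing in [m]; in fact
    every ['C(m, i) / 'C(m, l)] with [i <= l] is. *)
Require Import Defs.
From mathcomp Require Import all_boot all_order.
From mathcomp Require Import generic_quotient zify.

Local Open Scope quotient_scope.

Lemma card_tupleS (T : finType) n (P : pred (seq T)) :
  #|[set t : n.+1.-tuple T | P t]| =
    \sum_(x : T) #|[set t : n.-tuple T | P (x :: t)]|.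
Proof.
under eq_bigr do rewrite -sum1dep_card.
rewrite -sum1dep_card pair_big_dep /=.
rewrite (reindex (fun p : T * n.-tuple T => [tuple of p.1 :: p.2])) //=.
exists (fun t => (thead t, [tuple of behead t])) => [[x t] _ | t _] /=.
  by congr pair; apply: val_inj.
by rewrite -tuple_eta.
Qed.

Lemma sum_sign (F : sign -> nat) :
  \sum_(x : sign) F x = F Zero + F Plus + F Minus.
Proof.
rewrite (bigD1 Zero) //= (bigD1 Plus) //= (bigD1 Minus) //= big1 => [|[] //].
by rewrite addn0 addnA.
Qed.

(** The upper bound is strict, so [l = 0] gives the empty sum and Pascal's rule lowers [l] down to
    it; the second factor of [W_r] is [binsum r.-1 l.+1]. *)
Definition binsum m l := \sum_(0 <= i < l) 'C(m, i).

Lemma binsum_recr m l : binsum m l.+1 = binsum m l + 'C(m, l).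
Proof. by rewrite /binsum big_nat_recr. Qed.

Lemma binsumS m l : binsum m.+1 l.+1 = binsum m l.+1 + binsum m l.
Proof.
rewrite /binsum big_nat_recl // [in RHS]big_nat_recl // !bin0 -addnA.
by congr addn; rewrite -big_split; apply: eq_bigr => i _; rewrite binS.
Qed.

(** Here [a] is the last nonzero entry already read. The bound [< l] matches [binsum]: for [l = 0]
    nothing is counted. *)
Lemma card_nonzero_jumps n r l a : a != Zero ->
  #|[set t : n.-tuple sign |
      (nb_nonzero t == r) && (jumps (a :: support_seq t) < l)]| =
  'C(n, r) * binsum r l.
Proof.
elim: n r l a => [|n IH] r l a a0.
  case: r => [|r]; last first.
    by rewrite bin0n mul0n; apply: eq_card0 => t; rewrite inE tuple0.
  case: l => [|l].
    rewrite /binsum big_geq // muln0; apply: eq_card0 => t.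
    by rewrite inE ltn0 andbF.
  rewrite /binsum big_nat_recl // big1 // addn0 bin0 muln1.
  transitivity #|[set: 0.-tuple sign]|; last by rewrite cardsT card_tuple.
  by apply: eq_card => t; rewrite !inE tuple0.
case: l => [|l].
  rewrite /binsum big_geq // muln0; apply: eq_card0 => t.
  by rewrite inE ltn0 andbF.
rewrite (card_tupleS _ _ (fun s => (nb_nonzero s == r) &&
  (jumps (a :: support_seq s) < l.+1))) sum_sign -addnA IH //.
case: r => [|r].
  by rewrite !eq_card0 ?bin0 ?addn0 // => t; rewrite inE.
(* A first entry [Zero] keeps [a] and [r]. The entry [a] keeps the bound [l.+1], while [sopp a]
   spends one jump and leaves [l]. *)
rewrite binS mulnDl; congr addn; rewrite binsumS mulnDr -(IH r l.+1 a a0).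
rewrite -(IH r l (sopp a)); last by case: (a) a0.
case: a a0 => // _; last rewrite addnC; congr addn.
Qed.

(** Leading zeros are skipped by induction; once [Plus] is read, the previous count applies with
    [a = Plus]. *)
Lemma card_head_plus n r l :
  #|[set t : n.-tuple sign | [&& head Zero (support_seq t) == Plus,
      nb_nonzero t == r.+1 & sign_changes t <= l]]| =
  'C(n, r.+1) * binsum r l.+1.
Proof.
elim: n => [|n IH].
  by rewrite bin0n mul0n; apply: eq_card0 => t; rewrite inE tuple0.
rewrite (card_tupleS _ _ (fun s => [&& head Zero (support_seq s) == Plus,
      nb_nonzero s == r.+1 & sign_changes s <= l])) sum_sign IH.
rewrite [X in _ + X]eq_card0 ?addn0 => [|t]; last by rewrite inE.
by rewrite binS mulnDl -(card_nonzero_jumps n r l.+1 Plus).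
Qed.

Lemma head_support_opp s :
  head Zero (support_seq (map sopp s)) = sopp (head Zero (support_seq s)).
Proof. by elim: s => //= -[]. Qed.

Lemma head_support_nz n (v : nzvec n) : head Zero (support_seq (val v)) != Zero.
Proof.
have: 0 < nb_nonzero (val v) by rewrite nb_nonzero_gt0 (valP v).
by elim: (tval (val v)) => //= -[].
Qed.

Lemma whitney_Pnl n l r :
  whitney (@Pnl_rank n l) r.+1 = 'C(n, r.+1) * binsum r l.+1.
Proof.
rewrite -card_head_plus /whitney.
pose A := [set C : psv n | (psv_rank C == r.+1) && (psv_changes C <= l)].
pose B := [set v : nzvec n | [&& head Zero (support_seq (val v)) == Plus,
  nb_nonzero (val v) == r.+1 & sign_changes (val v) <= l]].
have -> : #|[set x : Pnl n l | Pnl_rank x == r.+1]| = #|A|.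
  rewrite -(card_imset _ val_inj); apply: eq_card => C; rewrite inE.
  apply/imsetP/andP => [[x] | [Cr Cl]].
    by rewrite inE => xr ->; split=> //; exact: (valP x).
  by exists (exist (fun C : psv n => psv_changes C <= l) _ Cl); rewrite ?inE.
have -> : A = [set \pi_(psv n) v | v in B].
  apply/setP => C; rewrite inE.
  apply/andP/imsetP => [[] | [v]]; last first.
    by rewrite inE => /and3P[_ vr vl] ->; rewrite psv_rank_pi psv_changes_pi.
  rewrite -[C]reprK; move: (repr C) => v; rewrite psv_rank_pi psv_changes_pi.
  move=> vr vl; have := head_support_nz _ v.
  (* If the head is [Minus], the opposite vector represents the same class. *)
  case E: (head _ _) => // _; first by exists v; rewrite ?inE ?E ?vr.
  have nz : [tuple of map sopp (val v)] != [tuple Zero | _ < n].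
    by rewrite -nb_nonzero_gt0 nb_nonzero_opp nb_nonzero_gt0 (valP v).
  pose u : nzvec n := exist (fun v : n.-tuple sign => v != _) _ nz.
  exists u; first by rewrite inE /= head_support_opp E nb_nonzero_opp
    sign_changes_opp vr.
  by apply/eqP; rewrite psv_eqE /nzvec_rel /= map_soppK eqxx orbT.
(* Negation turns head [Plus] into head [Minus], so no two distinct vectors of [B] share a class. *)
rewrite card_in_imset; last first.
  move=> v w; rewrite !inE => /and3P[/eqP vP _ _] /and3P[/eqP wP _ _] /eqP.
  rewrite psv_eqE => /orP[/eqP /val_inj // | /eqP E].
  by move: vP; rewrite E head_support_opp wP.
rewrite -(card_imset _ val_inj); apply: eq_card => t; rewrite inE.
apply/imsetP/idP => [[v] | tP]; first by rewrite inE => vP ->.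
have nz : t != [tuple Zero | _ < n].
  by rewrite -nb_nonzero_gt0; case/and3P: tP => _ /eqP-> _.
by exists (exist (fun v : n.-tuple sign => v != _) _ nz); rewrite ?inE.
Qed.

Lemma bin_log_concave n r : 'C(n, r) * 'C(n, r.+2) <= 'C(n, r.+1) ^ 2.
Proof.
have E1 := mul_bin_left n r; have E2 := mul_bin_left n r.+1.
have [le_nr | lt_rn] := leqP n r.
  by rewrite (@bin_small n r.+2) ?muln0 //; lia.
(* This positive factor clears the denominators of the ratios of consecutive binomials given by [E1]
   and [E2]. *)
rewrite -(@leq_pmul2l (r.+2 * (n - r))); last by rewrite muln_gt0 subn_gt0.
have -> : r.+2 * (n - r) * ('C(n, r) * 'C(n, r.+2)) =
  (n - r.+1) * r.+1 * 'C(n, r.+1) ^ 2.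
  nia.
by rewrite leq_mul2r mulnC leq_mul ?orbT //; lia.
Qed.

(** For [i <= m], the quotient of ['C(m.+1, i)] by ['C(m, i)] is [m.+1 / (m.+1 - i)], which grows
    with [i]. *)
Lemma bin_ratio m i l :
  i <= l -> 'C(m.+1, i) * 'C(m, l) <= 'C(m, i) * 'C(m.+1, l).
Proof.
move=> le_il; have [lt_ml | le_lm] := ltnP m l.
  by rewrite (bin_small lt_ml) muln0.
have Ei := mul_bin_down m.+1 i; have El := mul_bin_down m.+1 l.
rewrite -(@leq_pmul2l (m.+1 - l)) ?subn_gt0 ?ltnS //.
rewrite [X in _ <= X]mulnCA -El mulnCA mulnA /= mulnA [X in _ <= X * _]mulnC.
by rewrite Ei [X in X * _ <= _]mulnC !leq_mul //; lia.
Qed.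

Lemma binsum_log_concave m l :
  binsum m l * binsum m.+2 l <= binsum m.+1 l ^ 2.
Proof.
case: l => [|l]; first by rewrite /binsum big_geq.
have E0 : binsum m.+1 l.+1 + 'C(m, l) = 2 * binsum m l.+1.
  by rewrite binsumS -addnA -binsum_recr addnn mul2n.
have E1 : binsum m.+2 l.+1 + 'C(m.+1, l) = 2 * binsum m.+1 l.+1.
  by rewrite binsumS -addnA -binsum_recr addnn mul2n.
(* Expanding [binsum m.+2 l.+1] by [E1] and one factor of the square by [E0] leaves exactly this
   inequality, which holds term by term. *)
have : binsum m.+1 l.+1 * 'C(m, l) <= binsum m l.+1 * 'C(m.+1, l).
  rewrite /binsum !big_distrl !big_nat; apply: leq_sum => i /andP[_ le_il].
  exact: bin_ratio.
nia.
Qed.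

Theorem theorem5p2 (n l : nat) (hl : l < n) :
  (forall r : nat, 1 <= r <= n ->
     whitney (@Pnl_rank n l) r = 'C(n, r) * \sum_(0 <= i < l.+1) 'C(r.-1, i)) /\
  rank_log_concave (@Pnl_rank n l) n.
Proof.
split=> [[|r] // _ | [|[|i]] // _]; first exact: whitney_Pnl.
rewrite /= !whitney_Pnl mulnACA expnMn leq_mul ?bin_log_concave //.
exact: binsum_log_concave.
Qed.
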